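(* Let $R$ be a commutative ring with identity, let $A,B\in R$, and let $(w_n)_{n\ge0}$ be a sequence of elements of $R$ satisfying $w_{n+1}=Aw_n-Bw_{n-1}$ for all $n=1,2,3,\ldots$. Put $$A'=(A^2-B^2+1)w_0-2Aw_1\quad\text{and}\quad B'=\big(Aw_0-(B+1)w_1\big)^2.$$ Then for every positive integer $n$, $$\det[w_{|j-k|}]_{1\le j,k\le n}=w_0\,u_n(A',B')+\big((Bw_0)^2-(Aw_0-w_1)^2\big)\,u_{n-1}(A',B').$$
   Context: For elements $x,y$ of a commutative ring with identity, the Lucas sequence $(u_n(x,y))_{n\ge0}$ is defined by $u_0(x,y)=0$, $u_1(x,y)=1$, and $u_{n+1}(x,y)=xu_n(x,y)-yu_{n-1}(x,y)$ for $n\ge1$. *)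

(* Defs.v *)
From mathcomp Require Import all_boot all_order all_algebra.
Set Implicit Arguments.
Unset Strict Implicit.
Unset Printing Implicit Defensive.
Import GRing.Theory.
Local Open Scope ring_scope.

Fixpoint lucas (R : comPzRingType) (x y : R) (n : nat) : R :=
  match n with
  | 0 => 0
  | 1 => 1
  | (m.+1 as k).+1 => x * lucas x y k - y * lucas x y m
  end.

(* Main.v *)
(* Applying the recurrence operator X_i - A X_(i-1) + B X_(i-2) to all rows and
   columns of index at least 2 of the Toeplitz matrix amounts to a congruence by
   a unitriangular matrix, and makes the matrix tridiagonal: apart from its
   top-left 2 x 2 corner, its diagonal entries are A' and its off-diagonal ones
   c = (B + 1) w_1 - A w_0, with c^2 = B'.  Expanding along the last row thus
   gives the recurrence of the Lucas sequence u_n(A', B'). *)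
Require Import Defs.
From mathcomp Require Import all_boot all_order all_algebra.
From mathcomp Require Import zify ring.
Set Implicit Arguments.
Unset Strict Implicit.
Unset Printing Implicit Defensive.
Import GRing.Theory.
Local Open Scope ring_scope.

Lemma lucasSS (R : comPzRingType) (x y : R) (n : nat) :
  lucas x y n.+2 = x * lucas x y n.+1 - y * lucas x y n.
Proof. by []. Qed.

(** Entries are indexed by naturals, so that the minors of all sizes share one [f]. *)
Definition leading_minor (R : comPzRingType) (f : nat -> nat -> R) (n : nat) : R :=
  \det (\matrix_(i < n, j < n) f i j).

Lemma bump_lt (h k : nat) : (k < h)%N -> bump h k = k.
Proof. by rewrite /bump ltnNge => /negPf ->. Qed.

(** The last row has only two entries that can be non-zero. The minor of the off-diagonal one is
    expanded along its last column, where only [f n n.+1] survives. *)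
Lemma leading_minor_tridiag (R : comPzRingType) (f : nat -> nat -> R)
    (f_up : forall i j, (i.+1 < j)%N -> f i j = 0)
    (f_lo : forall i j, (j.+1 < i)%N -> f i j = 0) (n : nat) :
  leading_minor f n.+2 =
    f n.+1 n.+1 * leading_minor f n.+1 - f n n.+1 * f n.+1 n * leading_minor f n.
Proof.
rewrite /leading_minor (expand_det_row _ ord_max) big_ord_recr big_ord_recr /=.
rewrite big1 => [|i _]; last by rewrite mxE f_lo ?mul0r //=; have := ltn_ord i; lia.
rewrite add0r !mxE /= addrC; congr (_ + _).
  rewrite /cofactor -signr_odd addnn odd_double expr0 mul1r.
  congr (_ * \det _); apply/matrixP=> i j; by rewrite !mxE /= !bump_lt.
rewrite /cofactor /= addSn -signr_odd /= addnn odd_double expr1.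
rewrite (expand_det_col _ ord_max) big_ord_recr /=.
rewrite big1 => [|i _]; last first.
  by rewrite !mxE f_up ?mul0r //= /bump /=; have := ltn_ord i; lia.
rewrite add0r !mxE /cofactor -signr_odd addnn odd_double expr0 mul1r.
have -> : f (lift ord_max (@ord_max n))
    (lift (widen_ord (leqnSn n.+1) ord_max) (@ord_max n)) = f n n.+1.
  by congr f; rewrite /= /bump; lia.
set D1 := \det _; set D2 := \det _; suff -> : D1 = D2.
  by rewrite mulN1r mulrN mulrCA mulrA.
congr (\det _); apply/matrixP=> i j; rewrite !mxE /=.
by rewrite (bump_lt (ltn_ord i)) !(bump_lt (ltn_ord j)) bump_lt // ltnS ltnW.
Qed.

Definition rec_op (R : comPzRingType) (A B : R) (g : nat -> R) (i : nat) : R :=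
  if i is m.+2 then g m.+2 - A * g m.+1 + B * g m else g i.

(** The matrix of the linear operator [rec_op], read off from its action on indicator functions. *)
Definition rec_coef (R : comPzRingType) (A B : R) (i j : nat) : R :=
  rec_op A B (fun m => (j == m)%:R) i.

Lemma sum_delta (R : comPzRingType) (n i : nat) (g : nat -> R) :
  (i < n)%N -> \sum_(j < n) ((j : nat) == i)%:R * g j = g i.
Proof.
move=> lt_in; rewrite (bigD1 (Ordinal lt_in)) //= eqxx mul1r big1 ?addr0 // => j.
by rewrite -val_eqE /= => /negPf ->; rewrite mul0r.
Qed.

Lemma sum_rec_coef (R : comPzRingType) (A B : R) (n i : nat) (g : nat -> R) :
  (i < n)%N -> \sum_(j < n) rec_coef A B i j * g j = rec_op A B g i.
Proof.
rewrite /rec_coef; case: i => [|[|i]] lt_in /=; try exact: sum_delta.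
rewrite -!(@sum_delta _ n _ g) ?(ltnW lt_in) ?(ltnW (ltnW lt_in)) //.
rewrite !mulr_sumr -sumrB -big_split /=; apply: eq_bigr => j _.
by rewrite !mulrDl mulNr !mulrA.
Qed.

Lemma det_rec_coef (R : comPzRingType) (A B : R) (n : nat) :
  \det (\matrix_(i < n, j < n) rec_coef A B i j) = 1.
Proof.
rewrite det_trig.
  apply: big1 => -[[|[|i]] lt_in] _; rewrite mxE /rec_coef /= ?eqxx //.
  by rewrite (@gtn_eqF i) ?(@gtn_eqF i.+1) //=; ring.
apply/is_trig_mxP=> i j; rewrite mxE /rec_coef.
case: (nat_of_ord i) => [|[|k]] /= lt_kj; try by rewrite gtn_eqF.
rewrite (gtn_eqF lt_kj) (gtn_eqF (ltnW lt_kj)) (gtn_eqF (ltnW (ltnW lt_kj))).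
by rewrite /=; ring.
Qed.

(** With [L] the matrix of [rec_op] and F that of [f], the transformed matrix is [L] F [L^T], and
    [L] has determinant 1. *)
Lemma leading_minor_rec_op (R : comPzRingType) (A B : R) (f : nat -> nat -> R) (n : nat) :
  leading_minor (fun i k => rec_op A B (fun l => rec_op A B (f^~ l) i) k) n =
    leading_minor f n.
Proof.
pose L : 'M[R]_n := \matrix_(i, j) rec_coef A B i j.
have detL : \det L = 1 := det_rec_coef A B n.
have detLT : \det L^T = 1 by rewrite det_tr.
rewrite /leading_minor -[RHS]mul1r -[RHS]mulr1 -{1}detL -detLT -!det_mulmx.
congr (\det _); apply/matrixP=> i k.
rewrite !mxE -(sum_rec_coef _ _ _ (ltn_ord k)); apply: eq_bigr => l _.
rewrite !mxE mulrC -(sum_rec_coef _ _ _ (ltn_ord i)); congr (_ * _).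
by apply: eq_bigr => j _; rewrite !mxE.
Qed.

Section Toeplitz.

Variables (R : comPzRingType) (A B : R) (w : nat -> R).
Hypothesis hw : forall n : nat, (0 < n)%N -> w n.+1 = A * w n - B * w n.-1.

(** Subtraction is truncated, so one summand is zero and the index is |i - k|. *)
Let T (i k : nat) : R := w (i - k + (k - i)).
Let M (i k : nat) : R := rec_op A B (fun l => rec_op A B (T^~ l) i) k.
Let c : R := (B + 1) * w 1 - A * w 0.

Let wSS (m : nat) : w m.+2 = A * w m.+1 - B * w m.
Proof. exact: hw. Qed.

Let w_rec (m : nat) : w m.+2 - A * w m.+1 + B * w m = 0.
Proof. by rewrite wSS; ring. Qed.

Let rec_op_T_lo (i l : nat) : (l.+1 < i)%N -> rec_op A B (T^~ l) i = 0.
Proof.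
case: i => [|[|m]] // lt_lm; rewrite /= /T -(w_rec (m - l)).
by congr (w _ - _ * w _ + _ * w _); lia.
Qed.

(** The three entries lie at distances 1, 0, 1 from the diagonal: the index is reflected there,
    which breaks the recurrence and leaves the defect [c]. *)
Let rec_op_T_sub (m : nat) : rec_op A B (T^~ m.+1) m.+2 = c.
Proof.
transitivity (w 1 - A * w 0 + B * w 1); last by rewrite /c; ring.
by rewrite /= /T; congr (w _ - _ * w _ + _ * w _); lia.
Qed.

Let rec_op_T_up (m d : nat) :
  rec_op A B (T^~ (m.+2 + d)%N) m.+2 = w d - A * w d.+1 + B * w d.+2.
Proof. by rewrite /= /T; congr (w _ - _ * w _ + _ * w _); lia. Qed.

Let M_up (i k : nat) : (i.+1 < k)%N -> M i k = 0.
Proof.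
case: k => [|[|k]] //; rewrite /M !ltnS => le_ik.
case: i le_ik => [|[|i]] le_ik.
- rewrite /= /T -(w_rec k); by congr (w _ - _ * w _ + _ * w _); lia.
- rewrite /= /T -(w_rec k.-1); by congr (w _ - _ * w _ + _ * w _); lia.
(* Rows 0 and 1 are untouched by the row operation. In later rows it yields
   [w d - A * w d.+1 + B * w d.+2], a combination of shifts of [w], which satisfies the same
   recurrence in d and is killed by the column operation. *)
have [d ->] : exists d, k = (i.+2 + d)%N by exists (k - i.+2)%N; lia.
rewrite [LHS]/rec_op -!addnS !rec_op_T_up.
by rewrite !wSS; ring.
Qed.

Let M_lo (i k : nat) : (k.+1 < i)%N -> M i k = 0.
Proof.
case: k => [|[|k]] lt_ki; rewrite /M [LHS]/rec_op; try exact: rec_op_T_lo.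
rewrite !rec_op_T_lo; [ring|lia..].
Qed.

Let M_diag (m : nat) :
  M m.+2 m.+2 = (A ^+ 2 - B ^+ 2 + 1) * w 0 - A * w 1 *+ 2.
Proof.
(* The column operation combines [w 0 - A * w 1 + B * w 2], [c] and 0. *)
rewrite /M [LHS]/rec_op rec_op_T_sub (rec_op_T_lo (ltnSn _)).
have := rec_op_T_up m 0; rewrite addn0 => ->.
by rewrite wSS /c; ring.
Qed.

Let M_sub (m : nat) : M m.+2 m.+1 = c.
Proof.
case: m => [|m]; first exact: rec_op_T_sub.
rewrite /M [LHS]/rec_op rec_op_T_sub !rec_op_T_lo; [ring|lia..].
Qed.

Let M_sup (m : nat) : M m.+1 m.+2 = c.
Proof.
case: m => [|m]; first by rewrite /M /= /T /= /c; ring.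
rewrite /M [LHS]/rec_op rec_op_T_sub.
have := rec_op_T_up m 0; rewrite addn0 => ->.
have := rec_op_T_up m 1; rewrite addn1 => ->.
by rewrite !wSS /c; ring.
Qed.

Lemma leading_minor_toeplitz (n : nat) :
  let A' := (A ^+ 2 - B ^+ 2 + 1) * w 0 - A * w 1 *+ 2 in
  let B' := (A * w 0 - (B + 1) * w 1) ^+ 2 in
  leading_minor (fun i k => w (i - k + (k - i))) n.+1 =
    w 0 * lucas A' B' n.+1
    + ((B * w 0) ^+ 2 - (A * w 0 - w 1) ^+ 2) * lucas A' B' n.
Proof.
move=> A' B'; rewrite -(leading_minor_rec_op A B) -/M.
have M1 : leading_minor M 1 = w 0 by rewrite /leading_minor det_mx11 mxE.
elim/ltn_ind: n => -[|[|n]] IHn.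
- by rewrite M1 /=; ring.
(* The corner is unchanged, with determinant w_0^2 - w_1^2; subtracting w_0 A' gives the coefficient
   of u_(n-1). *)
- rewrite leading_minor_tridiag // M1 /leading_minor det_mx00 /= /M /= /T /= /A'.
  ring.
rewrite leading_minor_tridiag // M_diag M_sub M_sup !IHn // -/A'.
rewrite !(lucasSS A' B' n.+1) (lucasSS A' B' n).
by rewrite /B' /c; ring.
Qed.

End Toeplitz.

Theorem theorem1p1 (R : comPzRingType) (A B : R) (w : nat -> R)
    (hw : forall n : nat, (0 < n)%N -> w n.+1 = A * w n - B * w n.-1)
    (n : nat) (hn : (0 < n)%N) :
  let A' := (A ^+ 2 - B ^+ 2 + 1) * w 0%N - A * w 1%N *+ 2 in
  let B' := (A * w 0%N - (B + 1) * w 1%N) ^+ 2 in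
  \det (\matrix_(j < n, k < n) w `|j%:Z - k%:Z|%N) =
    w 0%N * lucas A' B' n
    + ((B * w 0%N) ^+ 2 - (A * w 0%N - w 1%N) ^+ 2) * lucas A' B' n.-1.
Proof.
case: n hn => // n _ A' B'; rewrite -(leading_minor_toeplitz hw).
by congr (\det _); apply/matrixP=> i k; rewrite !mxE; congr w; lia.
Qed.
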